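(* Let $X_1,\dots,X_n\in\mathbb{R}^p$ and $Y_1,\dots,Y_n\in\mathbb{R}^p$ be random vectors satisfying the standing assumptions listed in the context, let $D$ be a deterministic $n\times n$ diagonal matrix with positive diagonal entries $R_1,\dots,R_n$, and let $A$ be a deterministic positive definite $p\times p$ matrix with $A\succeq t\,\mathrm{Id}_p$ for some $t>0$. For deterministic vectors $\alpha\in\mathbb{R}^n$ and $x\in\mathbb{R}^p$ with $\|\alpha\|=\|x\|=1$ let $$h(\alpha;X)=n^{-1/2}\alpha^\top DX\left(\frac{X^\top D^2X}{n}+A\right)^{-1}x ,$$ and define $h(\alpha;Y)$ in the same way with $Y$ in place of $X$. Then, for a numerical constant $K$, $$\left|\mathbb{E}[h(\alpha;X)-h(\alpha;Y)]\right|\le K\sum_{i=1}^n\big(U_i(X_i)+U_i(Y_i)\big),$$ where $$U_i(X_i)\le K\left[\frac{R_i^2}{nt}\sqrt{b_{Q_2}(2;X_i)}\wedge1\right]\cdot\left[\frac1{\sqrt n}|\alpha_i|R_i\sqrt{b_L(2;X_i)}\sqrt{\frac{x^\top A^{-1}x}{t}}+\frac1nR_i^2\sqrt{b_L(4;X_i)}\sqrt{\frac{x^\top A^{-1}x}{t^2}}\right],$$ and $U_i(Y_i)$ satisfies the same bound with $Y_i$ in place of $X_i$.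
   Context: Notation: $X$ (resp. $Y$) is the $n\times p$ matrix whose $i$-th row is $X_i^\top$ (resp. $Y_i^\top$). $a\wedge b=\min(a,b)$; $\succeq$ is the Loewner order; $\|\cdot\|_{op}$ is the operator norm; $\|\cdot\|$ is the Euclidean norm. Standing assumptions: the ratio $p/n$ stays bounded away from $0$ and $\infty$; the $X_j$ are independent, the $Y_j$ are independent, and the $Y_j$'s are independent of the $X_j$'s; for each $j$, $X_j$ and $Y_j$ have mean $0$ and the same covariance matrix $\Sigma_j$. For $Z\in\{X_j,Y_j\}$ and $k\ge1$, $b_L(k;Z)$ and $b_{Q_2}(k;Z)$ are deterministic numbers (finite for the exponents that appear) such that $\mathbb{E}|Z^\top v|^k\le b_L(k;Z)$ for every deterministic unit vector $v$, and $\mathbb{E}|Z^\top MZ-\mathbb{E}[Z^\top MZ]|^k\le b_{Q_2}(k;Z)$ for every deterministic positive semidefinite $M$ with $\|M\|_{op}\le1$. Without loss of generality $b_L(k;Z)\le\sqrt{b_L(2k;Z)}$. *)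

(* Defs.v *)
From HB Require Import structures.
From mathcomp Require Import all_boot all_order all_algebra.
From mathcomp Require Import all_classical all_reals all_analysis.

Set Implicit Arguments.
Unset Strict Implicit.
Unset Printing Implicit Defensive.

Import Order.TTheory GRing.Theory Num.Theory.
Import numFieldNormedType.Exports.

Local Open Scope classical_set_scope.
Local Open Scope ring_scope.

Section LinearAlgebra.
Variable R : realType.

(* The library norm on matrices is the sup norm, so the Euclidean one is
   defined here. *)
Definition enorm p (v : 'cV[R]_p) : R := Num.sqrt (\sum_i v i 0 ^+ 2).

Definition dotp p (u v : 'cV[R]_p) : R := (u^T *m v) 0 0.

Definition qform p (M : 'M[R]_p) (v : 'cV[R]_p) : R := (v^T *m M *m v) 0 0.

Definition possemidef p (M : 'M[R]_p) : Prop :=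
  M^T = M /\ forall v, 0 <= qform M v.

Definition posdef p (M : 'M[R]_p) : Prop :=
  M^T = M /\ forall v, v != 0 -> 0 < qform M v.

Definition loewner_ge p (M N : 'M[R]_p) : Prop := possemidef (M - N).

Definition opnorm p (M : 'M[R]_p) : R :=
  sup [set enorm (M *m v) | v in [set v | enorm v <= 1]].

Definition hstat n p (D : 'M[R]_n) (A : 'M[R]_p)
    (alpha : 'cV[R]_n) (x : 'cV[R]_p) (M : 'M[R]_(n, p)) : R :=
  (Num.sqrt n%:R)^-1 *
  (alpha^T *m D *m M
   *m invmx (n%:R^-1 *: (M^T *m (D *m D) *m M) + A) *m x) 0 0.

(* The bracketed bound on U_i; here ri = R_i, ai = alpha_i, xAx = x^T A^{-1} x,
   l2 = b_L(2), l4 = b_L(4), q2 = b_{Q_2}(2). *)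
Definition U_bound (n : nat) (t xAx ri ai l2 l4 q2 : R) : R :=
  Num.min (ri ^+ 2 / (n%:R * t) * Num.sqrt q2) 1 *
  ((Num.sqrt n%:R)^-1 * `|ai| * ri * Num.sqrt l2 * Num.sqrt (xAx / t)
   + n%:R^-1 * ri ^+ 2 * Num.sqrt l4 * Num.sqrt (xAx / t ^+ 2)).

End LinearAlgebra.

Section RandomVectors.
Context d (T : measurableType d) (R : realType) (P : probability T R).

Definition measurable_mx m n (M : T -> 'M[R]_(m, n)) : Prop :=
  forall i j, measurable_fun [set: T] (fun w => M w i j).

Definition sigma_mx m n (M : T -> 'M[R]_(m, n)) : set (set T) :=
  <<s \bigcup_(ij in [set: 'I_m * 'I_n])
        preimage_set_system [set: T] (fun w => M w ij.1 ij.2) measurable >>.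

Definition independent_family (I : finType) (F : I -> set (set T)) : Prop :=
  forall (J : {set I}) (E : I -> set T), (forall i, i \in J -> F i (E i)) ->
    P (\bigcap_(i in [set` J]) E i) = (\prod_(i in J) P (E i))%E.

Definition independent_pair (F G : set (set T)) : Prop :=
  forall E1 E2, F E1 -> G E2 -> P (E1 `&` E2) = (P E1 * P E2)%E.

Definition independent_vectors n p (Z : 'I_n -> T -> 'cV[R]_p) : Prop :=
  independent_family (fun j => sigma_mx (Z j)).

Definition data_mx n p (Z : 'I_n -> T -> 'cV[R]_p) (w : T) : 'M[R]_(n, p) :=
  \matrix_(i, a) Z i w a 0.

Definition mean_zero p (Z : T -> 'cV[R]_p) : Prop :=
  forall a, ('E_P[(fun w => Z w a 0)%R] = 0)%E.

Definition has_covariance p (Z : T -> 'cV[R]_p) (S : 'M[R]_p) : Prop :=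
  forall a b, covariance P (fun w => Z w a 0) (fun w => Z w b 0) = (S a b)%:E.

(* b may take the value +oo, so that no moment is assumed finite at exponents
   for which b is not required to be finite. *)
Definition linear_moment_bound p (Z : T -> 'cV[R]_p) (b : nat -> \bar R)
    : Prop :=
  forall k : nat, (1 <= k)%N -> forall v : 'cV[R]_p, enorm v = 1 ->
    ('E_P[(fun w => `|dotp (Z w) v| ^+ k)%R] <= b k)%E.

Definition quadratic_moment_bound p (Z : T -> 'cV[R]_p) (b : nat -> \bar R)
    : Prop :=
  forall k : nat, (1 <= k)%N ->
    forall M : 'M[R]_p, possemidef M -> opnorm M <= 1 ->
    let m := fine ('E_P[(fun w => qform M (Z w))%R])%E in
    ('E_P[(fun w => `|qform M (Z w) - m| ^+ k)%R] <= b k)%E.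

(* bL and bQ are admissible b_L(.; Z) and b_{Q_2}(.; Z), finite at the exponents
   2 and 4, resp. 2. *)
Definition moment_bounds p (Z : T -> 'cV[R]_p) (bL bQ : nat -> \bar R)
    : Prop :=
  [/\ linear_moment_bound Z bL,
      quadratic_moment_bound Z bQ,
      forall k : nat, (1 <= k)%N -> (bL k <= sqrte (bL (2 * k)%N))%E &
      [/\ bL 2%N \is a fin_num, bL 4%N \is a fin_num & bQ 2%N \is a fin_num]].

End RandomVectors.

(* Main.v *)
Require Import Defs.
From HB Require Import structures.
From mathcomp Require Import all_boot all_order all_algebra.
From mathcomp Require Import ring lra.
From mathcomp Require Import all_classical all_reals all_analysis.
From mathcomp Require Import measurable_realfun.

Set Implicit Arguments.
Unset Strict Implicit.
Unset Printing Implicit Defensive.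

Import Order.TTheory GRing.Theory Num.Theory.
Import numFieldNormedType.Exports.

Local Open Scope classical_set_scope.
Local Open Scope ring_scope.

(** The rows of [X] are exchanged for those of [Y] one at a time (Lindeberg's
    method), and each exchange costs at most one bound for [X_i] plus one for
    [Y_i]; the constant is [K = 1].

    Fix a row [i], let [M] be the current data matrix with row [i] set to [0],
    and let [B] be its regularized Gram matrix, [u = n^(-1/2) M^T D alpha].
    When row [i] is filled with [z], the Gram matrix gains the rank-one term
    [r_i^2 z z^T / n], so the Sherman-Morrison formula gives
    ([hstat_replace_row])
      h = h(M) + L(z) / (1 + q(z)),
      L(z) = n^(-1/2) alpha_i r_i (z.a) - n^(-1) r_i^2 (z.b) (z.a),
    with [a = B^-1 x], [b = B^-1 u] and [q(z) = r_i^2 z^T B^-1 z / n >= 0].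
    Both [L] and [q] are polynomials of degree at most two in [z], so their
    means depend on the law of the centred row only through its covariance.
    Hence [E L / (1 + E q)] is the same for [X_i] and [Y_i], and what is left is
      E [L (E q - q) / ((1 + q) (1 + E q))].
    As [q] and [E q] are nonnegative, the fraction is at most [1] and at most
    [|q - E q|] in absolute value, which produces the minimum in the bound; the
    Cauchy-Schwarz inequality separates it from [L] ([row_expectation]).
    The norms of [a] and [b] are controlled by the ridge term alone:
    [A >= t Id] and [B >= A] give [|a|^2 <= x^T A^-1 x / t]
    ([ridge_inv_enorm]), and [|b|^2 <= |alpha|^2 / t] because
    [u = W^T alpha] and [B = W^T W + A] with the same [W = n^(-1/2) D M]
    ([ridge_inv_gram_enorm]).

    All this is for a deterministic [M]. The random one is independent of row
    [i], whether that row is [X_i] or [Y_i], since it only involves the [Y_j]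
    with [j < i] and the [X_j] with [j > i]. Taking the expectation over row
    [i] first is Fubini's theorem for the joint law of row [i] and the
    remaining rows, a product measure ([decoupling]); it applies because [h]
    is bounded ([hstat_le]). *)

(** * The Euclidean inner product and quadratic forms *)

Section Euclidean.
Context {R : realType}.
Implicit Types p : nat.

Lemma dotpC p (u v : 'cV[R]_p) : dotp u v = dotp v u.
Proof. by rewrite /dotp !mxE; apply: eq_bigr => i _; rewrite !mxE mulrC. Qed.

Lemma dotpDl p (u v w : 'cV[R]_p) : dotp (u + v) w = dotp u w + dotp v w.
Proof. by rewrite /dotp linearD mulmxDl mxE. Qed.

Lemma dotpZl p a (u v : 'cV[R]_p) : dotp (a *: u) v = a * dotp u v.
Proof. by rewrite /dotp linearZ -scalemxAl mxE. Qed.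

Lemma dotpDr p (u v w : 'cV[R]_p) : dotp w (u + v) = dotp w u + dotp w v.
Proof. by rewrite dotpC dotpDl !(dotpC w). Qed.

Lemma dotpZr p a (u v : 'cV[R]_p) : dotp v (a *: u) = a * dotp v u.
Proof. by rewrite dotpC dotpZl dotpC. Qed.

Lemma dotpNl p (u v : 'cV[R]_p) : dotp (- u) v = - dotp u v.
Proof. by rewrite -scaleN1r dotpZl mulN1r. Qed.

Lemma dotpNr p (u v : 'cV[R]_p) : dotp v (- u) = - dotp v u.
Proof. by rewrite dotpC dotpNl dotpC. Qed.

Lemma dotp0r p (u : 'cV[R]_p) : dotp u 0 = 0.
Proof. by rewrite -(scale0r 0) dotpZr mul0r. Qed.

Lemma dotp_mull m p (M : 'M[R]_(m, p)) u v :
  dotp (M *m u) v = dotp u (M^T *m v).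
Proof. by rewrite /dotp trmx_mul mulmxA. Qed.

Lemma dotp_sqrE p (u : 'cV[R]_p) : dotp u u = \sum_i u i 0 ^+ 2.
Proof. by rewrite /dotp mxE; apply: eq_bigr => i _; rewrite mxE expr2. Qed.

Lemma dotp_ge0 p (u : 'cV[R]_p) : 0 <= dotp u u.
Proof. by rewrite dotp_sqrE sumr_ge0// => i _; rewrite sqr_ge0. Qed.

Lemma dotp_eq0 p (u : 'cV[R]_p) : (dotp u u == 0) = (u == 0).
Proof.
apply/eqP/eqP => [|->]; last exact: dotp0r.
rewrite dotp_sqrE => /psumr_eq0P => h; apply/matrixP => i j.
have /eqP := h (fun i _ => sqr_ge0 (u i 0)) i isT.
by rewrite sqrf_eq0 !mxE (ord1 j) => /eqP.
Qed.

Lemma enormE p (u : 'cV[R]_p) : enorm u = Num.sqrt (dotp u u).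
Proof. by rewrite dotp_sqrE. Qed.

Lemma enorm_ge0 p (u : 'cV[R]_p) : 0 <= enorm u.
Proof. exact: sqrtr_ge0. Qed.

Lemma enorm_sqr p (u : 'cV[R]_p) : enorm u ^+ 2 = dotp u u.
Proof. by rewrite enormE sqr_sqrtr// dotp_ge0. Qed.

Lemma dotp_cauchy_schwarz p (u v : 'cV[R]_p) :
  dotp u v ^+ 2 <= dotp u u * dotp v v.
Proof.
have [/eqP|v0] := eqVneq (dotp v v) 0.
  by rewrite dotp_eq0 => /eqP ->; rewrite !dotp0r expr0n mulr0.
have vp : 0 < dotp v v by rewrite lt_neqAle eq_sym v0 dotp_ge0.
have := dotp_ge0 (dotp v v *: u - dotp u v *: v).
rewrite !(dotpDl, dotpDr, dotpNl, dotpNr, dotpZl, dotpZr) (dotpC v u).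
rewrite [leRHS](_ : _ = dotp v v * (dotp u u * dotp v v - dotp u v ^+ 2));
  last by ring.
by rewrite pmulr_rge0// subr_ge0.
Qed.

Lemma ler_norm_dotp p (u v : 'cV[R]_p) : `|dotp u v| <= enorm u * enorm v.
Proof.
rewrite -[leRHS]ger0_norm ?mulr_ge0 ?enorm_ge0// -ler_sqr ?nnegrE//.
by rewrite !real_normK ?num_real// exprMn !enorm_sqr dotp_cauchy_schwarz.
Qed.

Lemma enormZ p a (u : 'cV[R]_p) : enorm (a *: u) = `|a| * enorm u.
Proof.
by rewrite !enormE dotpZl dotpZr mulrA -expr2 sqrtrM ?sqr_ge0// sqrtr_sqr.
Qed.

Lemma enorm_eq0 p (u : 'cV[R]_p) : (enorm u == 0) = (u == 0).
Proof. by rewrite -dotp_eq0 -enorm_sqr sqrf_eq0. Qed.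

Lemma qformE p (M : 'M[R]_p) v : qform M v = dotp v (M *m v).
Proof. by rewrite /qform /dotp mulmxA. Qed.

Lemma qform_sum p (M : 'M[R]_p) v :
  qform M v = \sum_i \sum_j M i j * (v i 0 * v j 0).
Proof.
rewrite qformE /dotp mxE; apply: eq_bigr => i _.
rewrite !mxE big_distrr /=; apply: eq_bigr => j _; ring.
Qed.

Lemma posdef_unit p (B : 'M[R]_p) : posdef B -> B \in unitmx.
Proof.
move=> [BT B0]; rewrite -row_free_unit; apply: inj_row_free => v vB.
apply/eqP; apply: contraT => vn0.
have := B0 v^T; rewrite trmx_eq0 => /(_ vn0).
by rewrite /qform trmxK vB mul0mx mxE ltxx.
Qed.

End Euclidean.

(** * Regularized Gram matrices and their inverses *)

Section Ridge.
Context {R : realType} (p : nat) (A : 'M[R]_p) (t : R).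
Hypotheses (Apd : posdef A) (t0 : 0 < t) (tA : loewner_ge A t%:M).

Lemma qform_loewner v : t * dotp v v <= qform A v.
Proof.
have [_ /(_ v)] := tA; rewrite qformE mulmxBl mul_scalar_mx.
by rewrite dotpDr dotpNr dotpZr -qformE subr_ge0.
Qed.

Definition ridge n (k : R) (W : 'M[R]_(n, p)) : 'M[R]_p :=
  k *: (W^T *m W) + A.

Section OneRidge.
Context (n : nat) (k : R) (W : 'M[R]_(n, p)).
Hypothesis k0 : 0 <= k.
Let B := ridge k W.

Lemma qform_ridge v : qform B v = k * dotp (W *m v) (W *m v) + qform A v.
Proof.
by rewrite !qformE /B /ridge mulmxDl -scalemxAl dotpDr dotpZr dotp_mull mulmxA.
Qed.

Lemma qform_ridge_ge v : qform A v <= qform B v.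
Proof. by rewrite qform_ridge lerDr mulr_ge0// dotp_ge0. Qed.

Lemma posdef_ridge : posdef B.
Proof.
split => [|v v0]; last by apply: lt_le_trans _ (qform_ridge_ge v); apply Apd.2.
by rewrite /B/ridge linearD linearZ /= trmx_mul trmxK Apd.1.
Qed.

Lemma ridge_unit : B \in unitmx. Proof. exact: posdef_unit posdef_ridge. Qed.

Lemma ridge_inv_sym : (invmx B)^T = invmx B.
Proof. by rewrite trmx_inv posdef_ridge.1. Qed.

Lemma ridge_inv_coercive x :
  t * dotp (invmx B *m x) (invmx B *m x) <= dotp x (invmx B *m x).
Proof.
apply: le_trans (qform_loewner _) _; apply: le_trans (qform_ridge_ge _) _.
by rewrite qformE mulKVmx ?ridge_unit// dotpC.
Qed.

(** With [y = B^-1 x] and [z = A^-1 x], expand [0 <= (y - z)^T A (y - z)] and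
    use [y^T A y <= y^T B y = x^T y]. *)
Lemma ridge_inv_le x : dotp x (invmx B *m x) <= qform (invmx A) x.
Proof.
set y := invmx B *m x; set z := invmx A *m x.
have Az : A *m z = x by rewrite mulKVmx// posdef_unit.
have By : dotp x y = qform B y by rewrite qformE mulKVmx ?ridge_unit// dotpC.
have : 0 <= qform A (y - z).
  by apply: le_trans _ (qform_loewner _); rewrite mulr_ge0 ?dotp_ge0 ?ltW.
rewrite qformE mulmxBr Az !(dotpDl, dotpDr, dotpNl, dotpNr).
have -> : dotp z (A *m y) = dotp x y.
  by rewrite dotpC dotp_mull Apd.1 Az dotpC.
rewrite -qformE (dotpC y x) (dotpC z x) [qform (invmx A) x]qformE -/z.
have := qform_ridge_ge y; rewrite -By; lra.
Qed.

Lemma ridge_inv_enorm x :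
  enorm (invmx B *m x) <= Num.sqrt (qform (invmx A) x / t).
Proof.
rewrite enormE ler_sqrt; last first.
  rewrite divr_ge0 ?(ltW t0)//; apply: le_trans _ (ridge_inv_le x).
  by apply: le_trans _ (ridge_inv_coercive x); rewrite mulr_ge0 ?dotp_ge0 ?ltW.
rewrite ler_pdivlMr// mulrC.
exact: le_trans (ridge_inv_coercive x) (ridge_inv_le x).
Qed.

(** With [v = B^-1 (s W^T a)], both [t |v|^2 + |s W v|^2 <= v^T B v] and
    [v^T B v = a . (s W v) <= |a|^2 + |s W v|^2] hold, and the term [|s W v|^2]
    cancels. The bound depends neither on [W] nor on [k], so it also shows that
    the statistic is bounded ([hstat_le]). *)
Lemma ridge_inv_gram_enorm s (a : 'cV[R]_n) : s ^+ 2 = k ->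
  enorm (invmx B *m (s *: (W^T *m a))) <= Num.sqrt (dotp a a / t).
Proof.
move=> sk; set u := s *: _; set v := invmx B *m u.
rewrite enormE ler_sqrt ?divr_ge0 ?dotp_ge0 ?(ltW t0)// ler_pdivlMr// mulrC.
have Bv : qform B v = s * dotp a (W *m v).
  rewrite qformE mulKVmx ?ridge_unit// dotpZr dotpC.
  by rewrite dotp_mull trmxK.
have := dotp_ge0 (a - (s *: (W *m v))).
rewrite !(dotpDl, dotpDr, dotpNl, dotpNr, dotpZl, dotpZr) (dotpC (W *m v) a).
have := qform_loewner v; rewrite qform_ridge -sk in Bv.
have := dotp_ge0 (W *m v); have := dotp_ge0 a; have := sqr_ge0 s.
set X := dotp (W *m v) _ in Bv *; set Y := dotp a (W *m v) in Bv *.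
set Q := qform A v in Bv *; rewrite expr2 in Bv *; nra.
Qed.

Lemma ridge_inv_psd : possemidef (t *: invmx B).
Proof.
split => [|v]; first by rewrite linearZ /= ridge_inv_sym.
rewrite qformE -scalemxAl dotpZr mulr_ge0 ?(ltW t0)//.
by apply: le_trans _ (ridge_inv_coercive v); rewrite mulr_ge0 ?dotp_ge0 ?ltW.
Qed.

Lemma ridge_inv_opnorm : opnorm (t *: invmx B) <= 1.
Proof.
apply: ge_sup; first by exists (enorm (t *: invmx B *m 0)), 0 => //=;
  rewrite enormE dotp0r sqrtr0.
move=> _ [v /= v1 <-]; apply: le_trans v1.
rewrite -scalemxAl enormZ gtr0_norm//.
have [->|] := eqVneq (enorm (invmx B *m v)) 0; first by rewrite mulr0 enorm_ge0.
set N := enorm _ => Nn0.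
have Np : 0 < N by rewrite lt_neqAle eq_sym Nn0 enorm_ge0.
rewrite -(ler_pM2r Np) -mulrA -expr2 enorm_sqr.
apply: le_trans (ridge_inv_coercive v) _.
exact: le_trans (ler_norm _) (ler_norm_dotp _ _).
Qed.

End OneRidge.

Section RankOne.
Context (n : nat) (k : R) (W : 'M[R]_(n, p)).
Hypothesis k0 : 0 <= k.
Let B := ridge k W.

(** Checked by multiplying the right-hand side by [B + c w w^T]. *)
Lemma sherman_morrison c (w x : 'cV[R]_p) : 0 <= c ->
  let q := c * dotp w (invmx B *m w) in
  B + c *: (w *m w^T) \in unitmx ->
  invmx (B + c *: (w *m w^T)) *m x =
  invmx B *m x - (c * dotp w (invmx B *m x) / (1 + q)) *: (invmx B *m w).
Proof.
move=> c0 q u; apply: (can_inj (mulKmx u)); rewrite mulKVmx//.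
have q0 : 0 <= q.
  rewrite mulr_ge0//; apply: le_trans _ (ridge_inv_coercive W k0 _).
  by rewrite mulr_ge0 ?dotp_ge0 ?ltW.
have ww v : w *m w^T *m v = dotp w v *: w.
  by rewrite -mulmxA (mx11_scalar (w^T *m v)) mul_mx_scalar.
rewrite mulmxDl mulmxBr -scalemxAr !mulKVmx ?ridge_unit//.
rewrite -scalemxAl ww dotpDr dotpNr dotpZr -addrA -scaleNr.
rewrite scalerA -scalerDl -[X in _ + X *: _](_ : 0 = _) ?scale0r ?addr0//.
set y := dotp w (invmx B *m x); rewrite -/q.
have e : c * dotp w (invmx B *m w) = q by [].
rewrite mulrBr (mulrCA c) e; have : 1 + q != 0 by rewrite gt_eqF// ltr_pwDl.
by move=> ?; field.
Qed.

End RankOne.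
End Ridge.

(** * Replacing one row of the data matrix *)

Section LeaveOneOut.
Context {R : realType} (n p : nat) (A : 'M[R]_p) (t : R).
Hypotheses (Apd : posdef A) (t0 : 0 < t) (tA : loewner_ge A t%:M).
Variables (r : 'rV[R]_n) (alpha : 'cV[R]_n) (x : 'cV[R]_p).

Let D := diag_mx r.
Let k : R := n%:R^-1.
Let s : R := (Num.sqrt n%:R)^-1.

Let k0 : 0 <= k. Proof. by rewrite invr_ge0. Qed.
Let sk : s ^+ 2 = k. Proof. by rewrite exprVn sqr_sqrtr. Qed.

Definition gram (M : 'M[R]_(n, p)) := ridge A k (D *m M).

Let gram_unit M : gram M \in unitmx.
Proof. exact: (ridge_unit Apd _ k0). Qed.

(** The vectors [a = B^-1 x] and [b = B^-1 u], and the normalized inverse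
    [t *: B^-1]: with row [i] of [M] zero, they are what row [i] is tested
    against. *)
Definition loo_lin M : 'cV[R]_p := invmx (gram M) *m x.
Definition loo_quad M : 'cV[R]_p :=
  invmx (gram M) *m (s *: ((D *m M)^T *m alpha)).
Definition loo_proj M : 'M[R]_p := t *: invmx (gram M).

Lemma hstat_dotp M :
  hstat D A alpha x M =
  dotp (s *: ((D *m M)^T *m alpha)) (invmx (gram M) *m x).
Proof.
rewrite /hstat dotpZl /gram /ridge /dotp !trmx_mul !trmxK tr_diag_mx !mulmxA.
by [].
Qed.

(** Boundedness is what makes the statistic integrable without moment
    assumptions, and Fubini's theorem applicable to it. *)
Lemma hstat_le M : enorm alpha = 1 -> enorm x = 1 ->
  `|hstat D A alpha x M| <= Num.sqrt (1 / t).
Proof.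
move=> a1 x1; rewrite -[in leRHS](expr1n _ 2) -[in leRHS]a1 enorm_sqr.
rewrite hstat_dotp dotpC dotp_mull (ridge_inv_sym Apd _ k0).
apply: le_trans (ler_norm_dotp _ _) _; rewrite x1 mul1r.
exact: (ridge_inv_gram_enorm Apd t0 tA _ k0).
Qed.

Lemma loo_lin_enorm M :
  enorm (loo_lin M) <= Num.sqrt (qform (invmx A) x / t).
Proof. exact: (ridge_inv_enorm Apd t0 tA _ k0). Qed.

Lemma loo_quad_enorm M : enorm alpha = 1 ->
  enorm (loo_quad M) <= Num.sqrt (1 / t).
Proof.
move=> a1; rewrite -[in leRHS](expr1n _ 2) -[in leRHS]a1 enorm_sqr.
exact: (ridge_inv_gram_enorm Apd t0 tA _ k0).
Qed.

Lemma loo_proj_psd M : possemidef (loo_proj M).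
Proof. exact: (ridge_inv_psd Apd t0 tA _ k0). Qed.

Lemma loo_proj_opnorm M : opnorm (loo_proj M) <= 1.
Proof. exact: (ridge_inv_opnorm Apd t0 tA _ k0). Qed.

Section ReplaceRow.
Variables (i : 'I_n) (M : 'M[R]_(n, p)) (z : 'cV[R]_p).
Hypothesis Mi : row i M = 0.
Let ri := r 0 i.
Let M' := M + delta_mx i 0 *m z^T.

Let D_delta : D *m delta_mx i (0 : 'I_1) = ri *: delta_mx i 0.
Proof.
apply/matrixP => a b; rewrite mul_diag_mx !mxE; case: eqP => [->|] //=.
by rewrite !mulr0.
Qed.

Let DM' : D *m M' = D *m M + ri *: (delta_mx i 0 *m z^T).
Proof. by rewrite /M' mulmxDr mulmxA D_delta -scalemxAl. Qed.

Let DM_delta : (D *m M)^T *m delta_mx i (0 : 'I_1) = 0.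
Proof.
rewrite trmx_mul tr_diag_mx -mulmxA D_delta -scalemxAr.
rewrite -[_ *m _]trmxK trmx_mul trmxK trmx_delta -rowE Mi.
by rewrite trmx0 scaler0.
Qed.

Let delta_DM : delta_mx (0 : 'I_1) i *m (D *m M) = 0.
Proof. by rewrite -[LHS]trmxK trmx_mul trmx_delta DM_delta trmx0. Qed.

Let DM'_tr : (D *m M')^T = (D *m M)^T + ri *: (z *m delta_mx 0 i).
Proof.
by rewrite DM' linearD /= linearZ /= (trmx_mul (delta_mx _ _)) trmxK trmx_delta.
Qed.

(** The cross terms vanish because row [i] of [M] is zero. *)
Lemma gram_replace_row : gram M' = gram M + (k * ri ^+ 2) *: (z *m z^T).
Proof.
rewrite /gram /ridge DM'_tr DM'.
have := DM_delta; have := delta_DM; move: (D *m M) => W dW Wd.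
rewrite mulmxDl !mulmxDr -!scalemxAr -!scalemxAl mulmxA Wd mul0mx scaler0.
rewrite -(mulmxA z) dW mulmx0 scaler0 addr0 add0r.
rewrite -(mulmxA z) (mulmxA (delta_mx _ _)) mul_delta_mx.
rewrite [delta_mx 0 0](_ : _ = 1%:M) ?mul1mx; last first.
  by apply/matrixP => a b; rewrite !ord1 !mxE.
by rewrite scalerDr !scalerA addrAC expr2 ?mulrA.
Qed.

Lemma score_replace_row : s *: ((D *m M')^T *m alpha) =
  s *: ((D *m M)^T *m alpha) + (s * alpha i 0 * ri) *: z.
Proof.
rewrite DM'_tr mulmxDl scalerDr.
rewrite -scalemxAl -mulmxA -rowE (mx11_scalar (row i alpha)) mul_mx_scalar.
by rewrite !scalerA !mxE mulrAC.
Qed.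

(** The Sherman-Morrison formula, applied after both the Gram matrix and the
    vector [u] are split into old part and row [i]. The quadratic form in the
    denominator is written with [t *: B^-1], whose operator norm is at most
    [1], so that the quadratic moment bound applies to it. *)
Lemma hstat_replace_row :
  hstat D A alpha x M' = hstat D A alpha x M +
  (s * alpha i 0 * ri * dotp z (loo_lin M)
   - k * ri ^+ 2 * (dotp z (loo_quad M) * dotp z (loo_lin M)))
  / (1 + k * ri ^+ 2 / t * qform (loo_proj M) z).
Proof.
rewrite !hstat_dotp score_replace_row.
have := gram_unit M'; rewrite gram_replace_row => u.
have c0 : 0 <= k * ri ^+ 2 by rewrite mulr_ge0 ?sqr_ge0.
have -> := sherman_morrison Apd t0 tA k0 x c0 u.
rewrite -/(gram M) -/(loo_lin M).
set a := loo_lin M; set b := s *: _; set G := invmx _ in u *.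
have -> : k * ri ^+ 2 / t * qform (loo_proj M) z
    = k * ri ^+ 2 * dotp z (G *m z).
  rewrite /loo_proj qformE -scalemxAl dotpZr -/G.
  by have := t0; move=> /lt0r_neq0 ?; field.
set q := k * ri ^+ 2 * dotp z (G *m z).
have q0 : 1 + q != 0.
  rewrite gt_eqF// ltr_pwDl// mulr_ge0//.
  apply: le_trans _ (ridge_inv_coercive Apd tA (D *m M) k0 _).
  by rewrite mulr_ge0 ?dotp_ge0 ?ltW.
have bz : dotp b (G *m z) = dotp z (loo_quad M).
  by rewrite dotpC dotp_mull (ridge_inv_sym Apd _ k0).
clearbody a b G; rewrite !(dotpDl, dotpDr, dotpNl, dotpNr, dotpZl, dotpZr) bz.
by rewrite /q in q0 *; field.
Qed.

End ReplaceRow.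
End LeaveOneOut.

(** * Measurability of matrix operations *)

Section Measurability.
Context d (T : measurableType d) (R : realType).

(** [1 / y = y (y^2)^(-1)] reduces the claim to real powers of nonnegative
    numbers; at [y = 0] both sides are [0]. *)
Lemma measurable_funV (f : T -> R) : measurable_fun [set: T] f ->
  measurable_fun [set: T] (fun w => (f w)^-1).
Proof.
move=> mf.
rewrite (_ : (fun w => (f w)^-1) = f \* (fun w => (f w ^+ 2) `^ (-1))).
  apply: measurable_funM => //; apply: (measurableT_comp (measurable_powR _)).
  exact: measurable_funX.
apply/funext => w /=; rewrite powR_inv1 ?sqr_ge0//.
have [->|w0] := eqVneq (f w) 0; first by rewrite invr0 mul0r.
by rewrite expr2 invfM mulrA mulfV// mul1r.
Qed.

Lemma measurable_mx_cst m n (C : 'M[R]_(m, n)) :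
  measurable_mx (fun _ : T => C).
Proof. by move=> i j; exact: measurable_cst. Qed.

Lemma measurable_mx_tr m n (M : T -> 'M[R]_(m, n)) :
  measurable_mx M -> measurable_mx (fun w => (M w)^T).
Proof. by move=> mM i j; under eq_fun do rewrite mxE; exact: mM. Qed.

Lemma measurable_mxD m n (M N : T -> 'M[R]_(m, n)) :
  measurable_mx M -> measurable_mx N -> measurable_mx (fun w => M w + N w).
Proof.
move=> mM mN i j; under eq_fun do rewrite mxE.
by apply: measurable_funD; [exact: mM|exact: mN].
Qed.

Lemma measurable_mxZ m n (f : T -> R) (M : T -> 'M[R]_(m, n)) :
  measurable_fun [set: T] f -> measurable_mx M ->
  measurable_mx (fun w => f w *: M w).
Proof.
move=> mf mM i j; under eq_fun do rewrite mxE.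
by apply: measurable_funM => //; exact: mM.
Qed.

Lemma measurable_mxM m n q (M : T -> 'M[R]_(m, n)) (N : T -> 'M[R]_(n, q)) :
  measurable_mx M -> measurable_mx N -> measurable_mx (fun w => M w *m N w).
Proof.
move=> mM mN i j; under eq_fun do rewrite mxE.
apply: measurable_sum => l.
by apply: measurable_funM; [exact: mM|exact: mN].
Qed.

Lemma measurable_det n (M : T -> 'M[R]_n) :
  measurable_mx M -> measurable_fun [set: T] (fun w => \det (M w)).
Proof.
move=> mM; apply: measurable_sum => s.
apply: measurable_funM => //; apply: measurable_prod => i _; exact: mM.
Qed.

Lemma measurable_invmx n (M : T -> 'M[R]_n) :
  (forall w, M w \in unitmx) -> measurable_mx M ->
  measurable_mx (fun w => invmx (M w)).
Proof.
move=> uM mM; rewrite /invmx.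
under eq_fun do rewrite uM.
apply: measurable_mxZ; first exact/measurable_funV/measurable_det.
move=> i j; under eq_fun do rewrite mxE.
apply: measurable_funM => //; apply: measurable_det => a b.
by under eq_fun do rewrite !mxE; exact: mM.
Qed.

Lemma measurable_dotp p (Z : T -> 'cV[R]_p) v :
  measurable_mx Z -> measurable_fun [set: T] (fun w => dotp (Z w) v).
Proof.
move=> mZ; rewrite /dotp.
by apply: measurable_mxM; [exact: measurable_mx_tr|exact: measurable_mx_cst].
Qed.

Lemma measurable_qform p (M : 'M[R]_p) (Z : T -> 'cV[R]_p) :
  measurable_mx Z -> measurable_fun [set: T] (fun w => qform M (Z w)).
Proof.
move=> mZ; rewrite /qform; apply: measurable_mxM => //.
by apply: measurable_mxM; [exact: measurable_mx_tr|exact: measurable_mx_cst].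
Qed.

End Measurability.

(** * The Cauchy-Schwarz inequality from bounds on second moments *)

Section Moments.
Context d (T : measurableType d) (R : realType) (P : probability T R).

Lemma ge0_integral_le (f g : T -> R) (c : R) :
  measurable_fun [set: T] f -> measurable_fun [set: T] g ->
  (forall w, 0 <= f w <= g w) ->
  (\int[P]_w (g w)%:E <= c%:E)%E -> (\int[P]_w (f w)%:E <= c%:E)%E.
Proof.
move=> mf mg fg; apply: le_trans; apply: ge0_le_integral => //=.
- by move=> w _; have /andP[] := fg w; rewrite lee_fin.
- exact/measurable_EFinP.
- exact/measurable_EFinP.
- by move=> w _; have /andP[_] := fg w; rewrite lee_fin.
Qed.

Lemma ge0_integralZ_le (f : T -> R) (c k : R) :
  measurable_fun [set: T] f -> (forall w, 0 <= f w) -> 0 <= k ->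
  (\int[P]_w (f w)%:E <= c%:E)%E ->
  (\int[P]_w (k * f w)%:E <= (k * c)%:E)%E.
Proof.
move=> mf f0 k0 fc; under eq_integral do rewrite EFinM.
rewrite ge0_integralZl_EFin//; last exact/measurable_EFinP.
  by rewrite EFinM lee_wpmul2l// lee_fin.
by move=> w _; rewrite lee_fin.
Qed.

Lemma ge0_integralD_le (f g : T -> R) (a b : R) :
  measurable_fun [set: T] f -> measurable_fun [set: T] g ->
  (forall w, 0 <= f w) -> (forall w, 0 <= g w) ->
  (\int[P]_w (f w)%:E <= a%:E)%E -> (\int[P]_w (g w)%:E <= b%:E)%E ->
  (\int[P]_w (f w + g w)%:E <= (a + b)%:E)%E.
Proof.
move=> mf mg f0 g0 fa gb; under eq_integral do rewrite EFinD.
rewrite ge0_integralD//; first by rewrite EFinD leeD.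
- by move=> w _; rewrite lee_fin.
- exact/measurable_EFinP.
- by move=> w _; rewrite lee_fin.
- exact/measurable_EFinP.
Qed.

Lemma integrable_of_le (f : T -> R) (c : R) :
  measurable_fun [set: T] f -> (\int[P]_w `|f w|%:E <= c%:E)%E ->
  P.-integrable [set: T] (EFin \o f).
Proof.
move=> mf fc; apply/integrableP; split; first exact/measurable_EFinP.
by apply: le_lt_trans fc _; rewrite ltry.
Qed.

(** Stated with upper bounds on the second moments rather than with the
    moments themselves, since only such bounds are known. For [F, G > 0] it is
    the mean inequality [2 |f g| <= (G / F) f^2 + (F / G) g^2]; in general [F]
    and [G] are increased by a small positive [h]. *)
Lemma integral_cauchy_schwarz (f g : T -> R) (F G : R) :
  measurable_fun [set: T] f -> measurable_fun [set: T] g -> 0 <= F -> 0 <= G ->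
  (\int[P]_w (f w ^+ 2)%:E <= (F ^+ 2)%:E)%E ->
  (\int[P]_w (g w ^+ 2)%:E <= (G ^+ 2)%:E)%E ->
  (\int[P]_w `|f w * g w|%:E <= (F * G)%:E)%E.
Proof.
move=> mf mg.
have pos F' G' : 0 < F' -> 0 < G' ->
    (\int[P]_w (f w ^+ 2)%:E <= (F' ^+ 2)%:E)%E ->
    (\int[P]_w (g w ^+ 2)%:E <= (G' ^+ 2)%:E)%E ->
    (\int[P]_w `|f w * g w|%:E <= (F' * G')%:E)%E.
  move=> F0 G0 fF gG.
  have k0 : 0 <= G' / (2 * F') by rewrite divr_ge0 ?mulr_ge0 ?ltW.
  have l0 : 0 <= F' / (2 * G') by rewrite divr_ge0 ?mulr_ge0 ?ltW.
  have -> : F' * G' = G' / (2 * F') * F' ^+ 2 + F' / (2 * G') * G' ^+ 2.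
    by field; rewrite !gt_eqF.
  apply: (@ge0_integral_le _ (fun w => G' / (2 * F') * f w ^+ 2
                                 + F' / (2 * G') * g w ^+ 2)).
  - by apply: measurableT_comp => //; exact: measurable_funM.
  - by apply: measurable_funD; apply: measurable_funM => //;
      exact: measurable_funX.
  - move=> w; rewrite normr_ge0/= normrM -(real_normK (num_real (f w))).
    rewrite -(real_normK (num_real (g w))) -subr_ge0.
    set x := `|f w|; set y := `|g w|.
    rewrite [leRHS](_ : _ = (2 * F' * G')^-1 * (G' * x - F' * y) ^+ 2).
      by rewrite mulr_ge0 ?sqr_ge0// invr_ge0 !mulr_ge0// ltW.
    by field; rewrite !gt_eqF.
  - apply: ge0_integralD_le => [| |w|w||].
    + by apply: measurable_funM => //; exact: measurable_funX.
    + by apply: measurable_funM => //; exact: measurable_funX.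
    + by rewrite mulr_ge0 ?sqr_ge0.
    + by rewrite mulr_ge0 ?sqr_ge0.
    + apply: ge0_integralZ_le => //; first exact: measurable_funX.
      by move=> w; rewrite sqr_ge0.
    + apply: ge0_integralZ_le => //; first exact: measurable_funX.
      by move=> w; rewrite sqr_ge0.
move=> F0 G0 fF gG; apply/lee_addgt0Pr => e e0.
(* [h] is chosen so that [(F + h) (G + h) <= F G + h s <= F G + e]. *)
pose s := F + G + 1; have s0 : 0 < s by rewrite ltr_wpDl ?addr_ge0.
pose h := Num.min 1 (e / s).
have h0 : 0 < h by rewrite lt_min ltr01 divr_gt0.
have h1 : h <= 1 by rewrite ge_min lexx.
have hs : h * s <= e by rewrite -ler_pdivlMr// ge_min lexx orbT.
apply: le_trans (pos (F + h) (G + h) _ _ _ _) _.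
- by rewrite ltr_wpDl.
- by rewrite ltr_wpDl.
- apply: le_trans fF _.
  by rewrite lee_fin ler_sqr ?nnegrE ?addr_ge0 ?lerDl ?(ltW h0).
- apply: le_trans gG _.
  by rewrite lee_fin ler_sqr ?nnegrE ?addr_ge0 ?lerDl ?(ltW h0).
- rewrite -EFinD lee_fin; rewrite /s in hs.
  have : h * h <= h by rewrite ler_piMr// ltW.
  by move: (F) (G) (h) hs => a b c; nra.
Qed.

End Moments.

(** * Moments of one random row *)

Section RowMoments.
Context d (T : measurableType d) (R : realType) (P : probability T R).
Context (p : nat) (Z : T -> 'cV[R]_p) (S : 'M[R]_p) (bL bQ : nat -> \bar R).
Hypotheses (mZ : measurable_mx Z) (Z0 : mean_zero P Z).
Hypotheses (ZS : has_covariance P Z S) (Zb : moment_bounds P Z bL bQ).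

Let mdotp v : measurable_fun [set: T] (fun w => dotp (Z w) v).
Proof. exact: measurable_dotp. Qed.

Let mqform M : measurable_fun [set: T] (fun w => qform M (Z w)).
Proof. exact: measurable_qform. Qed.

(** The hypothesis is about unit vectors; homogeneity gives the other ones,
    and [k > 0] the zero vector. *)
Lemma linear_moment_le k v : (0 < k)%N -> bL k \is a fin_num ->
  (\int[P]_w (`|dotp (Z w) v| ^+ k)%:E <= (fine (bL k) * enorm v ^+ k)%:E)%E.
Proof.
move=> k0 fk; have [v0|v0] := eqVneq v 0.
  rewrite v0 enormE dotp0r sqrtr0 integral0_eq; last first.
    by move=> w _; rewrite dotp0r normr0 expr0n gtn_eqF.
  by rewrite expr0n gtn_eqF// mulr0.
have nv : enorm v != 0 by rewrite enorm_eq0.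
set u := (enorm v)^-1 *: v.
have u1 : enorm u = 1.
  by rewrite enormZ ger0_norm ?invr_ge0 ?enorm_ge0// mulVf.
have vu w : (`|dotp (Z w) v| ^+ k)%:E
          = ((enorm v ^+ k)%:E * (`|dotp (Z w) u| ^+ k)%:E)%E.
  rewrite -EFinM -exprMn -(ger0_norm (enorm_ge0 v)) -normrM -dotpZr scalerA.
  by rewrite mulfV// scale1r.
have lin_le : linear_moment_bound P Z bL by case: Zb.
have := lin_le k k0 u u1; rewrite unlock => uk.
rewrite mulrC EFinM fineK//.
under eq_integral => w _ do rewrite vu.
rewrite ge0_integralZl_EFin//.
all: try by rewrite exprn_ge0// enorm_ge0.
- by rewrite lee_wpmul2l// lee_fin exprn_ge0// enorm_ge0.
- by apply/measurable_EFinP/measurable_funX/measurableT_comp.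
Qed.

(** Also true for negative [x], for which the square root is [0]: the moment
    bounds need not be nonnegative when no unit vector exists. *)
Let le_sqr_sqrt (x : R) : x <= Num.sqrt x ^+ 2.
Proof.
have [x0|x0] := leP 0 x; first by rewrite sqr_sqrtr.
by rewrite (le_trans (ltW x0))// sqr_ge0.
Qed.

Let l2 := fine (bL 2%N).
Let l4 := fine (bL 4%N).
Let q2 := fine (bQ 2%N).

Lemma linear_moment2_le v :
  (\int[P]_w (dotp (Z w) v ^+ 2)%:E <= ((Num.sqrt l2 * enorm v) ^+ 2)%:E)%E.
Proof.
have f2 : bL 2%N \is a fin_num by case: Zb => _ _ _ [].
under eq_integral => w _ do rewrite -real_normK ?num_real//.
apply: le_trans (@linear_moment_le 2 v isT f2) _.
by rewrite lee_fin exprMn ler_wpM2r ?sqr_ge0 ?le_sqr_sqrt.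
Qed.

(** Cauchy-Schwarz reduces the mixed fourth moment to the pure ones. *)
Lemma linear_moment4_le u v :
  (\int[P]_w ((dotp (Z w) u * dotp (Z w) v) ^+ 2)%:E
   <= ((Num.sqrt l4 * (enorm u * enorm v)) ^+ 2)%:E)%E.
Proof.
have f4 : bL 4%N \is a fin_num by case: Zb => _ _ _ [].
have m4 a : (\int[P]_w ((dotp (Z w) a ^+ 2) ^+ 2)%:E
             <= ((Num.sqrt l4 * enorm a ^+ 2) ^+ 2)%:E)%E.
  under eq_integral => w _ do
    rewrite -(real_normK (num_real (dotp _ _))) -exprM.
  apply: le_trans (@linear_moment_le 4 a isT f4) _.
  by rewrite lee_fin exprMn -exprM ler_wpM2r ?exprn_ge0 ?enorm_ge0.
under eq_integral => w _ do
  rewrite exprMn -(ger0_norm (mulr_ge0 (sqr_ge0 (dotp (Z w) u))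
                                       (sqr_ge0 (dotp (Z w) v)))).
have nn (a : 'cV[R]_p) : 0 <= Num.sqrt l4 * enorm a ^+ 2.
  by rewrite mulr_ge0 ?sqr_ge0 ?sqrtr_ge0.
apply: (le_trans (integral_cauchy_schwarz _ _ (nn u) (nn v) (m4 u) (m4 v))).
- exact: measurable_funX.
- exact: measurable_funX.
- by rewrite lee_fin; have -> : forall a b c : R, a * b ^+ 2 * (a * c ^+ 2)
    = (a * (b * c)) ^+ 2 by move=> a b c; ring.
Qed.

Lemma integrable_coordM i j :
  P.-integrable [set: T] (EFin \o (fun w => Z w i 0 * Z w j 0)).
Proof.
have e a w : Z w a 0 = dotp (Z w) (delta_mx a 0).
  by rewrite /dotp -colE !mxE.
apply: integrable_of_le.
  by apply: measurable_funM; exact: mZ.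
under eq_integral => w _ do rewrite !e.
apply: (integral_cauchy_schwarz _ _ _ _
  (linear_moment2_le _) (linear_moment2_le _)).
- exact: mdotp.
- exact: mdotp.
- by rewrite mulr_ge0 ?sqrtr_ge0 ?enorm_ge0.
- by rewrite mulr_ge0 ?sqrtr_ge0 ?enorm_ge0.
Qed.

Lemma integrable_coord i : P.-integrable [set: T] (EFin \o (fun w => Z w i 0)).
Proof.
apply: (@le_integrable _ _ _ _ _ _ _
  (EFin \o (fun w => 1 + Z w i 0 * Z w i 0))) => //.
- by apply/measurable_EFinP; exact: mZ.
- move=> w _ /=; rewrite lee_fin -expr2 [leRHS]ger0_norm ?addr_ge0 ?sqr_ge0//.
  rewrite -(real_normK (num_real (Z w i 0))).
  by set y := `|_|; have := sqr_ge0 (y - 1); rewrite sqrrB1; nra.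
- exact: (integrableD _ (finite_measure_integrable_cst P 1 measurableT)
                        (integrable_coordM i i)).
Qed.

Lemma integral_coord i : \int[P]_w Z w i 0 = 0.
Proof. by have := Z0 i; rewrite unlock /Rintegral => ->. Qed.

Lemma integral_coordM i j : \int[P]_w (Z w i 0 * Z w j 0) = S i j.
Proof.
have := ZS i j; rewrite unlock !Z0 /= unlock => cov.
rewrite /Rintegral -[RHS]/(fine (S i j)%:E) -cov.
by congr fine; apply: eq_integral => w _; rewrite mulrfctE /= !subr0.
Qed.

Let Rintegral_sum (I : finType) (f : I -> T -> R) :
  (forall i, P.-integrable [set: T] (EFin \o f i)) ->
  P.-integrable [set: T] (EFin \o (fun w => \sum_i f i w)) /\
  \int[P]_w (\sum_i f i w) = \sum_i \int[P]_w f i w.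
Proof.
move=> fi; have e : EFin \o (fun w => \sum_i f i w) =
    (fun w => (\sum_i (f i w)%:E)%E).
  by apply/funext => w /=; rewrite -sumEFin.
split; first by rewrite e; apply: integrable_sum => // i _; exact: fi.
rewrite /Rintegral; under eq_integral do rewrite -sumEFin.
rewrite integral_sum//= -sum_fine// => i _.
exact: (integrable_fin_num measurableT (fi i)).
Qed.

Lemma integrable_dotp v :
  P.-integrable [set: T] (EFin \o (fun w => dotp (Z w) v)) /\
  \int[P]_w dotp (Z w) v = 0.
Proof.
have e : (fun w => dotp (Z w) v) = (fun w => \sum_i (v i 0 * Z w i 0)).
  apply/funext => w; rewrite /dotp mxE; apply: eq_bigr => i _.
  by rewrite mxE mulrC.
rewrite e; have vi i :
    P.-integrable [set: T] (EFin \o (fun w => v i 0 * Z w i 0)).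
  exact: (integrableZl measurableT _ (integrable_coord i)).
have [vI vE] := Rintegral_sum vi; split=> //; rewrite vE.
rewrite big1// => i _; rewrite RintegralZl//; last exact: integrable_coord.
by rewrite integral_coord mulr0.
Qed.

(** Together with [integrable_dotp], this is why the first two moments of a
    centred row enter only through its covariance [S]. *)
Lemma integrable_qform C :
  P.-integrable [set: T] (EFin \o (fun w => qform C (Z w))) /\
  \int[P]_w qform C (Z w) = \sum_i \sum_j C i j * S i j.
Proof.
rewrite (funext (fun w => qform_sum C (Z w))).
have cij i j : P.-integrable [set: T]
    (EFin \o (fun w => C i j * (Z w i 0 * Z w j 0))).
  exact: (integrableZl measurableT _ (integrable_coordM i j)).
have ci i := Rintegral_sum (cij i).
have [cI ->] := Rintegral_sum (fun i => (ci i).1); split=> //.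
apply: eq_bigr => i _; rewrite (ci i).2; apply: eq_bigr => j _.
by rewrite RintegralZl ?integral_coordM//; exact: integrable_coordM.
Qed.

(** * The expected effect of one random row *)

Section ShermanMorrisonExpectation.
Variables (M : 'M[R]_p) (a b : 'cV[R]_p) (c1 c2 kappa : R).
Hypotheses (Mpsd : possemidef M) (Mop : opnorm M <= 1) (kappa0 : 0 <= kappa).

Let m := \sum_i \sum_j M i j * S i j.
Let X w := dotp (Z w) a.
Let Y w := dotp (Z w) b.
Let Q w := qform M (Z w).
Let L w := c1 * X w - c2 * (Y w * X w).
Let rho w := (kappa * m - kappa * Q w) / ((1 + kappa * Q w) * (1 + kappa * m)).
Let tau := Num.min (kappa * Num.sqrt q2) 1.

Let Q0 w : 0 <= Q w. Proof. exact: Mpsd.2. Qed.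

Let mE : m = \int[P]_w Q w. Proof. by rewrite (integrable_qform M).2. Qed.

Let m0 : 0 <= m. Proof. by rewrite mE Rintegral_ge0. Qed.

Let Q1 w : 0 < 1 + kappa * Q w. Proof. by rewrite ltr_pwDl// mulr_ge0. Qed.

Let m1 : 0 < 1 + kappa * m. Proof. by rewrite ltr_pwDl// mulr_ge0. Qed.

Let tau0 : 0 <= tau.
Proof. by rewrite le_min ler01 mulr_ge0 ?sqrtr_ge0. Qed.

Let mX : measurable_fun [set: T] X. Proof. exact: mdotp. Qed.

Let mY : measurable_fun [set: T] Y. Proof. exact: mdotp. Qed.

Let mQ : measurable_fun [set: T] Q. Proof. exact: mqform. Qed.

Let mrho : measurable_fun [set: T] rho.
Proof.
apply: measurable_funM.
  by apply: measurable_funB => //; exact: measurable_funM.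
apply: measurable_funV; apply: measurable_funM => //.
by apply: measurable_funD => //; exact: measurable_funM.
Qed.

(** The first bound uses that the denominator is at least [1], the second that
    it is at least [|kappa Q - kappa m|]. *)
Let rho_sqr_le w :
  rho w ^+ 2 <= kappa ^+ 2 * `|Q w - m| ^+ 2 /\ rho w ^+ 2 <= 1.
Proof.
have den : 1 <= (1 + kappa * Q w) * (1 + kappa * m).
  by have := mulr_ge0 kappa0 (Q0 w); have := mulr_ge0 kappa0 m0; nra.
rewrite /rho exprMn exprVn real_normK ?num_real//.
have den2 : 1 <= ((1 + kappa * Q w) * (1 + kappa * m)) ^+ 2.
  by rewrite exprn_ege1.
rewrite !ler_pdivrMr ?(lt_le_trans ltr01)// mul1r; split.
  rewrite -mulrBr -opprB exprMn sqrrN ler_peMr// mulr_ge0 ?sqr_ge0//.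
rewrite -[leLHS]real_normK ?num_real// ler_sqr ?nnegrE//; last first.
  exact: le_trans den.
have := mulr_ge0 kappa0 (Q0 w); have := mulr_ge0 kappa0 m0.
by rewrite ler_norml => *; apply/andP; split; nra.
Qed.

Let integral_rho_sqr_le : (\int[P]_w (rho w ^+ 2)%:E <= (tau ^+ 2)%:E)%E.
Proof.
have quad : quadratic_moment_bound P Z bQ by case: Zb.
have f2 : bQ 2%N \is a fin_num by case: Zb => _ _ _ [].
rewrite /tau; have [_|_] := leP (kappa * Num.sqrt q2) 1.
- have := quad 2%N isT M Mpsd Mop.
  rewrite unlock -[fine _]/(\int[P]_w Q w) -mE => Qm.
  rewrite exprMn.
  apply: (@ge0_integral_le _ _ _ _ _ (fun w => kappa ^+ 2 * `|Q w - m| ^+ 2)).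
  + exact: measurable_funX.
  + apply: measurable_funM => //; apply: measurable_funX.
    by apply: measurableT_comp => //; exact: measurable_funB.
  + by move=> w; rewrite sqr_ge0/= (rho_sqr_le w).1.
  + apply: ge0_integralZ_le; rewrite ?sqr_ge0//.
      apply: measurable_funX; apply: measurableT_comp => //.
      exact: measurable_funB.
    by apply: le_trans Qm _; rewrite -(fineK f2) lee_fin.
- apply: (@ge0_integral_le _ _ _ _ _ (cst 1)) => //.
  + exact: measurable_funX.
  + by move=> w; rewrite sqr_ge0/= (rho_sqr_le w).2.
  + have := @expectation_cst _ _ _ P 1; rewrite unlock expr1n => ->.
    exact: lexx.
Qed.

Let Lrho (f : T -> R) F : measurable_fun [set: T] f -> 0 <= F ->
  (\int[P]_w (f w ^+ 2)%:E <= (F ^+ 2)%:E)%E ->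
  P.-integrable [set: T] (EFin \o (fun w => f w * rho w)) /\
  `|\int[P]_w (f w * rho w)| <= F * tau.
Proof.
move=> mf F0 fF.
have := integral_cauchy_schwarz mf mrho F0 tau0 fF integral_rho_sqr_le.
have mfr : measurable_fun [set: T] (fun w => f w * rho w).
  exact: measurable_funM.
move=> h; have fI := integrable_of_le mfr h; split => //.
apply: le_trans (le_normr_Rintegral measurableT fI) _.
rewrite -lee_fin fineK//; apply: integrable_fin_num => //.
exact: integrable_norm.
Qed.

Let integrable_L : P.-integrable [set: T] (EFin \o L) /\
  \int[P]_w L w = - c2 * \sum_i \sum_j (b *m a^T) i j * S i j.
Proof.
have YX w : Y w * X w = qform (b *m a^T) (Z w).
  rewrite qformE -mulmxA (mx11_scalar (a^T *m _)) mul_mx_scalar dotpZr.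
  by rewrite mulrC /X dotpC.
have [XI XE] := integrable_dotp a; have [QI QE] := integrable_qform (b *m a^T).
have c1X := integrableZl measurableT c1 XI.
have c2Q := integrableZl measurableT c2 QI.
have -> : L = (fun w => c1 * X w - c2 * qform (b *m a^T) (Z w)).
  by apply/funext => w; rewrite -YX.
split; first exact: (integrableB measurableT c1X c2Q).
by rewrite RintegralB// !RintegralZl// XE QE mulr0 add0r mulNr.
Qed.

(** [L / (1 + kappa Q)] is [L / (1 + kappa m)] plus [L rho]. The expectation of
    the former is the subtracted quantity, which depends on the law of [Z] only
    through [S]; the two terms of [L rho] are bounded by Cauchy-Schwarz. *)
Lemma row_expectation :
  P.-integrable [set: T] (EFin \o (fun w => L w / (1 + kappa * Q w))) /\
  `|\int[P]_w (L w / (1 + kappa * Q w))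
    - - c2 * (\sum_i \sum_j (b *m a^T) i j * S i j) / (1 + kappa * m)|
  <= tau * (`|c1| * Num.sqrt l2 * enorm a
            + `|c2| * Num.sqrt l4 * (enorm b * enorm a)).
Proof.
have [LI LE] := integrable_L.
have e : (fun w => L w / (1 + kappa * Q w)) = (fun w =>
    (1 + kappa * m)^-1 * L w + (c1 * (X w * rho w) - c2 * (Y w * X w * rho w))).
  apply/funext => w; rewrite /rho /L; field.
  by rewrite !gt_eqF// ?Q1 ?m1.
have [XI XE] := Lrho (mdotp a) (mulr_ge0 (sqrtr_ge0 l2) (enorm_ge0 a))
  (linear_moment2_le a).
have mYX : measurable_fun [set: T] (fun w => Y w * X w).
  by apply: measurable_funM; exact: mdotp.
have [YI YE] := Lrho mYX
  (mulr_ge0 (sqrtr_ge0 l4) (mulr_ge0 (enorm_ge0 b) (enorm_ge0 a)))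
  (linear_moment4_le b a).
have LI' := integrableZl measurableT (1 + kappa * m)^-1 LI.
have XI' := integrableZl measurableT c1 XI.
have YI' := integrableZl measurableT c2 YI.
have XYI := integrableB measurableT XI' YI'.
rewrite e; split; first exact: (integrableD measurableT LI' XYI).
rewrite RintegralD// RintegralB// !RintegralZl// LE.
rewrite [X in `|X|](_ : _ = c1 * \int[P]_w (X w * rho w)
  - c2 * \int[P]_w (Y w * X w * rho w)); last by ring.
apply: le_trans (ler_normB _ _) _; rewrite !normrM mulrDr.
apply: lerD; rewrite mulrC.
  rewrite [leRHS](_ : _ = Num.sqrt l2 * enorm a * tau * `|c1|); last by ring.
  by rewrite ler_wpM2r.
rewrite [leRHS](_ : _ = Num.sqrt l4 * (enorm b * enorm a) * tau * `|c2|);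
  last by ring.
by rewrite ler_wpM2r.
Qed.

End ShermanMorrisonExpectation.
End RowMoments.

(** * Independence and iterated expectations *)

Section Independence.
Context d (T : measurableType d) (R : realType) (P : probability T R).
Context (I : finType) (F : I -> set (set T)).

(** A generating system of the sigma-algebra of the sub-family indexed by [J]
    that, unlike the union of the [F j], is stable under intersections. *)
Definition cylinders (J : {set I}) : set (set T) :=
  [set A | exists2 E : I -> set T, forall i, F i (E i) &
           A = \bigcap_(i in [set` J]) E i].

Hypotheses (Fm : forall i, F i `<=` measurable) (FT : forall i, F i [set: T]).
Hypothesis FI : forall i, setI_closed (F i).

Lemma cylinder_coord (J : {set I}) i : i \in J -> F i `<=` cylinders J.
Proof.
move=> iJ A FA; exists (fun j => if j == i then A else setT).
  by move=> j; case: eqP => [->|_].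
apply/seteqP; split=> [w Aw j _|w]; first by case: eqP.
by move/(_ i iJ); rewrite eqxx.
Qed.

Let cylinders_setI J : setI_closed (cylinders J).
Proof.
move=> _ _ [E FE ->] [E' FE' ->]; exists (fun i => E i `&` E' i).
  by move=> i; exact: FI.
by rewrite bigcapI.
Qed.

Let cylindersT J : cylinders J [set: T].
Proof. by exists (fun=> setT) => //; rewrite bigcapT. Qed.

Lemma cylinders_measurable J : cylinders J `<=` measurable.
Proof.
move=> _ [E FE ->]; apply: fin_bigcap_measurable => // i _.
exact/Fm/FE.
Qed.

(** For fixed [A] in [F i], the finite measures [B |-> P (B `&` A)] and
    [B |-> P A * P B] agree on cylinders, hence on the sigma-algebra that they
    generate. *)
Lemma independent_cylinders i (J : {set I}) : i \notin J ->
  independent_family P F -> independent_pair P (F i) <<s cylinders J >>.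
Proof.
move=> iJ indep A B FA sB; have mA := Fm FA.
pose m1 : {measure set T -> \bar R} := mrestr P mA.
have PA0 : 0 <= fine (P A) by rewrite fine_ge0.
pose m2 : {measure set T -> \bar R} := mscale (NngNum PA0) P.
have m2E X : m2 X = (P A * P X)%E.
  by rewrite /m2/= /mscale/= fineK// fin_num_measure.
have m1E : m1 B = m2 B.
  apply: (@g_sigma_algebra_measure_unique _ _ _ (cylinders J) _
    (fun=> setT)) => //.
  - exact: cylinders_measurable.
  - by apply/seteqP; split => // w _; exists 0%N.
  - move=> _ [E FE ->]; rewrite m2E /m1/= /mrestr.
    pose E' j := if j == i then A else E j.
    have FE' j : F j (E' j) by rewrite /E'; case: eqP => [->|].
    have EJ : \bigcap_(j in [set` J]) E j = \bigcap_(j in [set` J]) E' j.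
      apply: eq_bigcapr => j jJ; rewrite /E'; case: eqP => // ji.
      by move: iJ; rewrite -ji jJ.
    have -> : \bigcap_(j in [set` J]) E j `&` A
        = \bigcap_(j in [set` (i |: J)%SET]) E' j.
      rewrite EJ; apply/seteqP; split=> [w [Jw Aw] j /=|w Jw].
        by rewrite !inE => /predU1P[->|jJ]; [rewrite /E' eqxx|exact: Jw].
      split=> [j jJ|]; first by apply: Jw => /=; rewrite !inE jJ orbT.
      by have := Jw i; rewrite /= /E' eqxx; apply; rewrite !inE eqxx.
    rewrite (indep (i |: J)%SET)// big_setU1//= EJ (indep J)//.
    by rewrite /E' eqxx.
  - move=> _; rewrite /m1 /= /mrestr setTI ltey_eq.
    by rewrite fin_num_measure.
by rewrite setIC -m2E -m1E.
Qed.

End Independence.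

Section Decoupling.
Context d d1 d2 (T : measurableType d) (T1 : measurableType d1)
  (T2 : measurableType d2) (R : realType) (P : probability T R).

Lemma bounded_integrable d' (T' : measurableType d') (Q : probability T' R)
    (f : T' -> R) (c : R) :
  measurable_fun [set: T'] f -> (forall w, `|f w| <= c) ->
  Q.-integrable [set: T'] (EFin \o f).
Proof.
move=> mf fc; apply: (@le_integrable _ _ _ _ _ _ _ (EFin \o cst c)) => //.
- exact/measurable_EFinP.
- by move=> w _ /=; rewrite lee_fin (le_trans (fc w))// ler_norm.
- exact: finite_measure_integrable_cst.
Qed.

Variables (V : T -> T1) (W : T -> T2) (f : T1 * T2 -> R) (c : R).
Hypotheses (mV : measurable_fun [set: T] V) (mW : measurable_fun [set: T] W).
Hypothesis VW : forall A B, measurable A -> measurable B ->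
  P (V @^-1` A `&` W @^-1` B) = (P (V @^-1` A) * P (W @^-1` B))%E.
Hypotheses (mf : measurable_fun [set: T1 * T2] f) (fc : forall z, `|f z| <= c).

(** Independence says that the law of [(V, W)] and the product of the laws of
    [V] and [W] agree on rectangles, hence everywhere; then Fubini's theorem
    applies. The inner variable [v] is a copy of the sample point that is
    independent of [w]. *)
Lemma decoupling :
  P.-integrable [set: T] (EFin \o (fun w => \int[P]_v f (V v, W w))) /\
  \int[P]_w f (V w, W w) = \int[P]_w \int[P]_v f (V v, W w).
Proof.
pose V' : {mfun T >-> T1} :=
  MeasurableFun.Pack (MeasurableFun.Class (isMeasurableFun.Build _ _ _ _ _ mV)).
pose W' : {mfun T >-> T2} :=
  MeasurableFun.Pack (MeasurableFun.Class (isMeasurableFun.Build _ _ _ _ _ mW)).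
have mD := measurable_fun_pair mV mW.
pose D' : {mfun T >-> (T1 * T2)%type} :=
  MeasurableFun.Pack (MeasurableFun.Class (isMeasurableFun.Build _ _ _ _ _ mD)).
pose m1 : probability T1 R := distribution P V'.
pose m2 : probability T2 R := distribution P W'.
have imf : (m1 \x m2)%E.-integrable [set: T1 * T2] (EFin \o f).
  exact: (bounded_integrable _ mf fc).
pose g y := (\int[m1]_x (f (x, y))%:E)%E.
have mfy y : measurable_fun [set: T1] (fun x => f (x, y)).
  by apply: measurableT_comp => //; exact: measurable_fun_pair.
have mfVy y : measurable_fun [set: T] (fun v => f (V v, y)).
  by have := measurableT_comp (mfy y) mV.
have gE y : g y = (\int[P]_v (f (V v, y))%:E)%E.
  rewrite /g (@integral_distribution _ _ _ _ _ P V' (fun x => (f (x, y))%:E))//.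
    by apply/measurable_EFinP; exact: mfy.
  by apply: (@bounded_integrable _ _ P (fun v => f (V v, y)) c).
have gfin y : g y \is a fin_num.
  rewrite gE; apply: integrable_fin_num => //.
  by apply: (@bounded_integrable _ _ P (fun v => f (V v, y)) c).
have mg : measurable_fun [set: T2] g := measurable_fubini_G imf.
have inner w : \int[P]_v f (V v, W w) = fine (g (W w)).
  by rewrite gE.
have gb y : `|fine (g y)| <= c.
  have -> : fine (g y) = \int[P]_v f (V v, y) by rewrite gE.
  have fyI : P.-integrable [set: T] (EFin \o (fun v => f (V v, y))).
    exact: (bounded_integrable _ (mfVy y)).
  apply: le_trans (le_normr_Rintegral measurableT fyI) _.
  have <- : \int[P]_(v in [set: T]) c = c.
    by rewrite Rintegral_cst// [X in fine X]probability_setT mulr1.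
  apply: le_Rintegral => //; first exact: integrable_norm.
  exact: finite_measure_integrable_cst.
have mgW : measurable_fun [set: T] (fun w => fine (g (W w))).
  have mfg : measurable_fun [set: T2] (fine \o g) by exact: measurableT_comp.
  exact: (measurableT_comp mfg mW).
rewrite (funext inner); split.
  exact: (bounded_integrable _ mgW (fun w => gb (W w))).
rewrite /Rintegral; congr fine.
have -> : (\int[P]_w (f (V w, W w))%:E = \int[distribution P D']_z (f z)%:E)%E.
  rewrite integral_distribution//; first exact/measurable_EFinP.
  by apply: (@bounded_integrable _ _ P (fun w => f (V w, W w)) c) => //;
    exact: measurableT_comp.
transitivity (\int[m1 \x m2]_z (f z)%:E)%E.
  apply: eq_measure_integral => A mA _.
  by apply/esym/product_measure_unique.
rewrite -integral21_prod_meas1//.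
rewrite (@integral_distribution _ _ _ _ _ P W' g)//.
  apply: eq_integral => w _ /=; rewrite -/(g _) fineK//.
rewrite (_ : g \o W' = EFin \o (fun w => fine (g (W w)))); last first.
  by apply/funext => w /=; rewrite fineK.
exact: (bounded_integrable _ mgW (fun w => gb (W w))).
Qed.

End Decoupling.

(** * Sigma-algebras of random matrices *)

Section SigmaMx.
Context d (T : measurableType d) (R : realType) (m n : nat).
Variable M : T -> 'M[R]_(m, n).

(** The generators of [sigma_mx M], named so that the sample space can carry
    the sigma-algebra of [M] as a measurable structure. *)
Definition coordinate_events : set (set T) :=
  \bigcup_(ij in [set: 'I_m * 'I_n])
    preimage_set_system [set: T] (fun w => M w ij.1 ij.2) measurable.

Lemma sigma_mx_coordinate i j (B : set R) : measurable B ->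
  sigma_mx M ((fun w => M w i j) @^-1` B).
Proof.
move=> mB; apply: sub_sigma_algebra; exists (i, j) => //=.
by exists B => //; rewrite setTI.
Qed.

Lemma sigma_mxT : sigma_mx M [set: T].
Proof. exact: (@measurableT _ (g_sigma_algebraType coordinate_events)). Qed.

Lemma sigma_mx_setI : setI_closed (sigma_mx M).
Proof. exact: (@measurableI _ (g_sigma_algebraType coordinate_events)). Qed.

Lemma sigma_mx_sub (B : set (set T)) : sigma_algebra [set: T] B ->
  (forall i j C, measurable C -> B ((fun w => M w i j) @^-1` C)) ->
  sigma_mx M `<=` B.
Proof.
move=> sB BM; apply: smallest_sub => // _ [[i j] _ [C mC <-]].
by rewrite setTI; exact: BM.
Qed.

Lemma sigma_mx_measurable : measurable_mx M -> sigma_mx M `<=` measurable.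
Proof.
move=> mM; apply: sigma_mx_sub => [|i j C mC].
  exact: sigma_algebra_measurable.
by rewrite -[X in measurable X]setTI; exact: mM.
Qed.

End SigmaMx.

Section JoinFamilies.
Context d (T : measurableType d) (R : realType) (P : probability T R).
Context (n p : nat) (X Y : 'I_n -> T -> 'cV[R]_p).

Definition join_family (s : 'I_n + 'I_n) : T -> 'cV[R]_p :=
  match s with inl j => X j | inr j => Y j end.

Lemma sigma_mx_row (Z : 'I_n -> T -> 'cV[R]_p) j :
  sigma_mx (Z j) `<=` sigma_mx (data_mx Z).
Proof.
apply: sigma_mx_sub; first exact: smallest_sigma_algebra.
move=> a b C mC.
rewrite (_ : (fun w => Z j w a b) = (fun w => data_mx Z w j a)).
  exact: sigma_mx_coordinate.
by apply/funext => w; rewrite mxE (ord1 b).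
Qed.

(** An intersection of events of the joined family splits into an event of the
    [X] data and an event of the [Y] data, to which the independence of the two
    data matrices applies; each factor is then split within its own family. *)
Lemma independent_join_family :
  independent_vectors P X -> independent_vectors P Y ->
  independent_pair P (sigma_mx (data_mx X)) (sigma_mx (data_mx Y)) ->
  independent_family P (fun s => sigma_mx (join_family s)).
Proof.
move=> iX iY iXY J E JE.
pose JX := [set j | inl j \in J]%SET; pose JY := [set j | inr j \in J]%SET.
have sX : sigma_mx (data_mx X) (\bigcap_(j in [set` JX]) E (inl j)).
  apply: (@fin_bigcap_measurable _ (g_sigma_algebraType
    (coordinate_events (data_mx X)))) => // j.
  by rewrite /= inE => jJ; apply: (@sigma_mx_row X j); exact: (JE _ jJ).
have sY : sigma_mx (data_mx Y) (\bigcap_(j in [set` JY]) E (inr j)).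
  apply: (@fin_bigcap_measurable _ (g_sigma_algebraType
    (coordinate_events (data_mx Y)))) => // j.
  by rewrite /= inE => jJ; apply: (@sigma_mx_row Y j); exact: (JE _ jJ).
have -> : \bigcap_(s in [set` J]) E s = \bigcap_(j in [set` JX]) E (inl j)
    `&` \bigcap_(j in [set` JY]) E (inr j).
  apply/seteqP; split => [w Jw|w [Xw Yw] [j|j] /= jJ].
  - by split => j /=; rewrite inE => /Jw.
  - by apply: Xw; rewrite /= inE.
  - by apply: Yw; rewrite /= inE.
rewrite iXY// iX; last by move=> j; rewrite inE => /JE.
rewrite iY; last by move=> j; rewrite inE => /JE.
rewrite big_sumType/=; congr (_ * _)%E; apply: eq_bigl => j; by rewrite inE.
Qed.

End JoinFamilies.

(** * The statistic with one random row *)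

Section MeasurableStatistic.
Context d (T : measurableType d) (R : realType) (n p : nat).
Variables (A : 'M[R]_p) (r : 'rV[R]_n) (alpha : 'cV[R]_n) (x : 'cV[R]_p).

Lemma measurable_hstat (M : T -> 'M[R]_(n, p)) : posdef A ->
  measurable_mx M ->
  measurable_fun [set: T] (fun w => hstat (diag_mx r) A alpha x (M w)).
Proof.
move=> Apd mM; under eq_fun do rewrite hstat_dotp.
have mDM : measurable_mx (fun w => diag_mx r *m M w).
  by apply: measurable_mxM => //; exact: measurable_mx_cst.
have mDMT : measurable_mx (fun w => (diag_mx r *m M w)^T).
  exact: measurable_mx_tr.
rewrite /dotp; apply: measurable_mxM.
  apply: measurable_mx_tr; apply: measurable_mxZ => //.
  by apply: measurable_mxM => //; exact: measurable_mx_cst.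
apply: measurable_mxM; last exact: measurable_mx_cst.
apply: measurable_invmx => [w|].
  by apply: ridge_unit => //; rewrite invr_ge0.
rewrite /gram /ridge; apply: measurable_mxD; last exact: measurable_mx_cst.
by apply: measurable_mxZ => //; exact: measurable_mxM.
Qed.

End MeasurableStatistic.

Section OneRow.
Context d (T : measurableType d) (R : realType) (P : probability T R).
Context (n p : nat) (A S : 'M[R]_p) (t : R) (Z : T -> 'cV[R]_p).
Variables (bL bQ : nat -> \bar R).
Variables (r : 'rV[R]_n) (alpha : 'cV[R]_n) (x : 'cV[R]_p) (i : 'I_n).
Hypotheses (mZ : measurable_mx Z) (Z0 : mean_zero P Z).
Hypotheses (ZS : has_covariance P Z S) (Zb : moment_bounds P Z bL bQ).
Hypothesis r0 : 0 < r 0 i.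
Hypotheses (Apd : posdef A) (t0 : 0 < t) (tA : loewner_ge A t%:M).
Hypotheses (alpha1 : enorm alpha = 1).

(** The value that the expectation of the statistic is compared with. The law
    of row [i] enters it only through the covariance [S], so it is the same for
    both candidates for that row. *)
Definition row_center (M : 'M[R]_(n, p)) : R :=
  hstat (diag_mx r) A alpha x M +
  - (n%:R^-1 * r 0 i ^+ 2) *
  (\sum_a \sum_b (loo_quad A r alpha M *m (loo_lin A r x M)^T) a b * S a b)
  / (1 + n%:R^-1 * r 0 i ^+ 2 / t *
     \sum_a \sum_b loo_proj A t r M a b * S a b).

Lemma row_center_le (M : 'M[R]_(n, p)) : row i M = 0 ->
  `|\int[P]_w hstat (diag_mx r) A alpha x (M + delta_mx i 0 *m (Z w)^T)
    - row_center M|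
  <= U_bound n t (qform (invmx A) x) (r 0 i) (alpha i 0)
       (fine (bL 2%N)) (fine (bL 4%N)) (fine (bQ 2%N)).
Proof.
move=> Mi; pose s : R := (Num.sqrt n%:R)^-1.
pose c1 := s * alpha i 0 * r 0 i; pose c2 := n%:R^-1 * r 0 i ^+ 2.
have c20 : 0 <= c2 by rewrite mulr_ge0 ?sqr_ge0 ?invr_ge0.
have k0 : 0 <= c2 / t by rewrite divr_ge0// ltW.
have [I E] := row_expectation mZ Z0 ZS Zb (loo_lin A r x M)
  (loo_quad A r alpha M) c1 c2 (loo_proj_psd Apd t0 tA r M)
  (loo_proj_opnorm Apd t0 tA r M) k0.
under eq_Rintegral => w _ do rewrite (hstat_replace_row Apd t0 tA _ _ _ _ Mi).
rewrite RintegralD//; last exact: finite_measure_integrable_cst.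
rewrite Rintegral_cst// [X in fine X]probability_setT mulr1.
rewrite /row_center opprD addrACA subrr add0r.
apply: le_trans E _.
have kE : c2 / t = r 0 i ^+ 2 / (n%:R * t).
  by rewrite /c2 invfM; ring.
rewrite /U_bound -kE; apply: ler_pM.
- by rewrite le_min ler01 mulr_ge0 ?sqrtr_ge0.
- by rewrite addr_ge0// !mulr_ge0 ?sqrtr_ge0 ?enorm_ge0.
- exact: lexx.
have s0 : 0 <= s by rewrite invr_ge0 sqrtr_ge0.
apply: lerD.
  rewrite /c1 !normrM (ger0_norm s0) (gtr0_norm r0).
  by rewrite ler_wpM2l ?mulr_ge0 ?sqrtr_ge0 ?(ltW r0)// loo_lin_enorm.
rewrite (ger0_norm c20) ler_wpM2l ?(mulr_ge0 c20) ?sqrtr_ge0//.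
have -> : qform (invmx A) x / t ^+ 2 = (1 / t) * (qform (invmx A) x / t).
  by rewrite expr2 invfM; ring.
rewrite sqrtrM ?divr_ge0 ?(ltW t0)//.
by rewrite ler_pM ?enorm_ge0 ?loo_lin_enorm ?loo_quad_enorm.
Qed.

End OneRow.

(** * Exchanging the rows one by one *)

Section ReplaceIndependentRow.
Context d (T : measurableType d) (R : realType) (P : probability T R).
Context (n p : nat) (A : 'M[R]_p) (t : R).
Variables (r : 'rV[R]_n) (alpha : 'cV[R]_n) (x : 'cV[R]_p) (i : 'I_n).
Hypotheses (Apd : posdef A) (t0 : 0 < t) (tA : loewner_ge A t%:M).
Hypotheses (alpha1 : enorm alpha = 1) (x1 : enorm x = 1).
Context (I : finType) (Z : I -> T -> 'cV[R]_p).
Hypotheses (mZ : forall s, measurable_mx (Z s)).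
Hypothesis indepZ : independent_family P (fun s => sigma_mx (Z s)).
Variables (s0 : I) (J : {set I}).
Hypothesis s0J : s0 \notin J.

Local Notation sigma_rest :=
  (g_sigma_algebraType (cylinders (fun s => sigma_mx (Z s)) J)).

(** The two factors of the product space are the sample space itself, with the
    sigma-algebra of row [s0] and with that of the rows in [J]; the two random
    elements are both the identity. This avoids putting a measurable structure
    on matrices. *)
Lemma decouple_row (M : T -> 'M[R]_(n, p)) :
  measurable_mx (M : sigma_rest -> _) ->
  let h w v := hstat (diag_mx r) A alpha x (M w + delta_mx i 0 *m (Z s0 v)^T) in
  P.-integrable [set: T] (EFin \o (fun w => \int[P]_v h w v)) /\
  \int[P]_w h w w = \int[P]_w \int[P]_v h w v.
Proof.
move=> mM h.
pose T1 := g_sigma_algebraType (coordinate_events (Z s0)).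
have FT s : sigma_mx (Z s) [set: T] by exact: sigma_mxT.
have Fm s : sigma_mx (Z s) `<=` measurable by exact: sigma_mx_measurable.
have FI s : setI_closed (sigma_mx (Z s)) by exact: sigma_mx_setI.
have sub : <<s cylinders (fun s => sigma_mx (Z s)) J >> `<=` measurable.
  apply: smallest_sub; first exact: sigma_algebra_measurable.
  exact: cylinders_measurable.
pose V : T -> T1 := id; pose W : T -> sigma_rest := id.
pose f (z : T1 * sigma_rest) := h z.2 z.1.
have mV : measurable_fun [set: T] V.
  by move=> _ B mB; rewrite setTI; exact: (Fm s0).
have mW : measurable_fun [set: T] W.
  by move=> _ B mB; rewrite setTI; exact: sub.
have VW B C : measurable B -> measurable C ->
    P (V @^-1` B `&` W @^-1` C) = (P (V @^-1` B) * P (W @^-1` C))%E.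
  by move=> mB mC; exact: (independent_cylinders Fm FT FI s0J indepZ).
have mf : measurable_fun [set: T1 * sigma_rest] f.
  apply: measurable_hstat => //; apply: measurable_mxD.
    by move=> a b; exact: (measurableT_comp (mM a b) measurable_snd).
  apply: measurable_mxM; first exact: measurable_mx_cst.
  apply: measurable_mx_tr => a b.
  have mV0 : measurable_fun [set: T1] (fun v => Z s0 v a b).
    by move=> _ B mB; rewrite setTI; exact: sigma_mx_coordinate.
  exact: (measurableT_comp mV0 measurable_fst).
exact: (decoupling mV mW VW mf (fun z => hstat_le Apd t0 tA _ _ alpha1 x1)).
Qed.

End ReplaceIndependentRow.

Section Lindeberg.
Context d (T : measurableType d) (R : realType) (P : probability T R).
Context (n p : nat) (X Y : 'I_n -> T -> 'cV[R]_p) (Sigma : 'I_n -> 'M[R]_p).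
Variables (bLX bQX bLY bQY : 'I_n -> nat -> \bar R).
Hypotheses (mX : forall j, measurable_mx (X j)).
Hypotheses (mY : forall j, measurable_mx (Y j)).
Hypotheses (iX : independent_vectors P X) (iY : independent_vectors P Y).
Hypothesis iXY :
  independent_pair P (sigma_mx (data_mx X)) (sigma_mx (data_mx Y)).
Hypotheses (X0 : forall j, mean_zero P (X j)).
Hypotheses (Y0 : forall j, mean_zero P (Y j)).
Hypotheses (XS : forall j, has_covariance P (X j) (Sigma j)).
Hypotheses (YS : forall j, has_covariance P (Y j) (Sigma j)).
Hypotheses (Xb : forall j, moment_bounds P (X j) (bLX j) (bQX j)).
Hypotheses (Yb : forall j, moment_bounds P (Y j) (bLY j) (bQY j)).
Variables (r : 'rV[R]_n) (A : 'M[R]_p) (t : R).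
Variables (alpha : 'cV[R]_n) (x : 'cV[R]_p).
Hypotheses (r0 : forall i, 0 < r 0 i) (Apd : posdef A) (t0 : 0 < t).
Hypotheses (tA : loewner_ge A t%:M) (alpha1 : enorm alpha = 1).
Hypothesis x1 : enorm x = 1.

Definition hybrid (k : nat) (w : T) : 'M[R]_(n, p) :=
  \matrix_(j, a) (if (j < k)%N then Y j w a 0 else X j w a 0).

(** The common part of the consecutive [hybrid i] and [hybrid i.+1]. *)
Definition punctured (i : 'I_n) (w : T) : 'M[R]_(n, p) :=
  \matrix_(j, a) (if j == i then 0
                  else if (j < i)%N then Y j w a 0 else X j w a 0).

Let H := hstat (diag_mx r) A alpha x.

Let U (bL bQ : 'I_n -> nat -> \bar R) i :=
  U_bound n t (qform (invmx A) x) (r 0 i) (alpha i 0)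
    (fine (bL i 2%N)) (fine (bL i 4%N)) (fine (bQ i 2%N)).

Lemma row_punctured i w : row i (punctured i w) = 0.
Proof. by apply/rowP => a; rewrite !mxE eqxx. Qed.

Lemma hybrid_X (i : 'I_n) w :
  hybrid i w = punctured i w + delta_mx i 0 *m (X i w)^T.
Proof.
apply/matrixP => j a; rewrite !mxE big_ord1 !mxE andbT.
have [->|ji] := eqVneq j i; first by rewrite ltnn mul1r add0r.
by rewrite mul0r addr0.
Qed.

Lemma hybrid_Y (i : 'I_n) w :
  hybrid i.+1 w = punctured i w + delta_mx i 0 *m (Y i w)^T.
Proof.
apply/matrixP => j a; rewrite !mxE big_ord1 !mxE andbT.
have [->|ji] := eqVneq j i; first by rewrite ltnS leqnn mul1r add0r.
by rewrite mul0r addr0 ltnS leq_eqVlt -[nat_of_ord j == i]/(j == i) (negPf ji).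
Qed.

Lemma measurable_hybrid k : measurable_mx (hybrid k).
Proof.
move=> j a; under eq_fun do rewrite mxE.
by case: (j < k)%N; [exact: mY|exact: mX].
Qed.

Definition retained_rows (i : 'I_n) : {set 'I_n + 'I_n} :=
  [set s : 'I_n + 'I_n |
    match s with inl j => (i < j)%N | inr j => (j < i)%N end]%SET.

Local Notation sigma_rest i := (g_sigma_algebraType
  (cylinders (fun s => sigma_mx (join_family X Y s)) (retained_rows i))).

Lemma measurable_punctured i :
  measurable_mx (punctured i : sigma_rest i -> _).
Proof.
have FT s : sigma_mx (join_family X Y s) [set: T] by exact: sigma_mxT.
have coord s j a : s \in retained_rows i -> measurable_fun
    [set: sigma_rest i] (fun w => join_family X Y s w j a).
  move=> sJ _ B mB; rewrite setTI; apply: sub_sigma_algebra.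
  by apply: (cylinder_coord FT sJ); exact: sigma_mx_coordinate.
move=> j a; rewrite [X in measurable_fun _ X](_ : _ = fun w => if j == i then 0
  else if (j < i)%N then Y j w a 0 else X j w a 0); last first.
  by apply/funext => w; rewrite mxE.
have [_|ji] := eqVneq j i; first exact: measurable_cst.
case: ltnP => ij.
  by apply: (coord (inr j)); rewrite inE.
by apply: (coord (inl j)); rewrite inE ltn_neqAle ij andbT eq_sym.
Qed.

(** After conditioning on the other rows, both expectations are close to the
    same [row_center], because [X i] and [Y i] have the same covariance. *)
Lemma swap_row (i : 'I_n) :
  `|\int[P]_w H (hybrid i.+1 w) - \int[P]_w H (hybrid i w)| <=
  U bLX bQX i + U bLY bQY i.
Proof.
have mZ s : measurable_mx (join_family X Y s) by case: s.
have indepZ := independent_join_family iX iY iXY.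
have XJ : inl i \notin retained_rows i by rewrite inE ltnn.
have YJ : inr i \notin retained_rows i by rewrite inE ltnn.
have mM := @measurable_punctured i.
have [XI XE] := decouple_row r i Apd t0 tA alpha1 x1 mZ indepZ XJ mM.
have [YI YE] := decouple_row r i Apd t0 tA alpha1 x1 mZ indepZ YJ mM.
pose gX w := \int[P]_v H (punctured i w + delta_mx i 0 *m (X i v)^T).
pose gY w := \int[P]_v H (punctured i w + delta_mx i 0 *m (Y i v)^T).
have -> : \int[P]_w H (hybrid i w) = \int[P]_w gX w.
  by rewrite -[RHS]XE; apply: eq_Rintegral => w _; rewrite hybrid_X.
have -> : \int[P]_w H (hybrid i.+1 w) = \int[P]_w gY w.
  by rewrite -[RHS]YE; apply: eq_Rintegral => w _; rewrite hybrid_Y.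
have gXI : P.-integrable [set: T] (EFin \o gX) by exact: XI.
have gYI : P.-integrable [set: T] (EFin \o gY) by exact: YI.
rewrite -(RintegralB measurableT gYI gXI).
have dI := integrableB measurableT gYI gXI.
apply: le_trans (le_normr_Rintegral measurableT dI) _.
set c := U _ _ _ + _; have <- : \int[P]_(w in [set: T]) c = c.
  by rewrite Rintegral_cst// [X in fine X]probability_setT mulr1.
apply: le_Rintegral; [by []|exact: integrable_norm| |].
  exact: finite_measure_integrable_cst.
move=> w _; rewrite /= /gX /gY /c.
have cX := row_center_le x (mX i) (X0 i) (XS i) (Xb i) (r0 i) Apd t0 tA
  alpha1 (row_punctured i w).
have cY := row_center_le x (mY i) (Y0 i) (YS i) (Yb i) (r0 i) Apd t0 tA
  alpha1 (row_punctured i w).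
rewrite distrC in cX; rewrite [leRHS]addrC; apply: le_trans _ (lerD cY cX).
by apply: le_trans _ (ler_normD _ _); rewrite addrA subrK.
Qed.

Lemma lindeberg :
  `|\int[P]_w (H (data_mx X w) - H (data_mx Y w))| <=
  \sum_(i < n) (U bLX bQX i + U bLY bQY i).
Proof.
have hI k : P.-integrable [set: T] (EFin \o (fun w => H (hybrid k w))).
  apply: (bounded_integrable _ _ (fun w => hstat_le Apd t0 tA _ _ alpha1 x1)).
  by apply: measurable_hstat => //; exact: measurable_hybrid.
have -> : data_mx X = hybrid 0.
  by apply/funext => w; apply/matrixP => j a; rewrite !mxE.
have -> : data_mx Y = hybrid n.
  by apply/funext => w; apply/matrixP => j a; rewrite !mxE ltn_ord.
rewrite RintegralB// distrC.
rewrite -(telescope_sumr (fun k => \int[P]_w H (hybrid k w)) (leq0n n)).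
rewrite big_mkord; apply: le_trans (ler_norm_sum _ _ _) _.
by apply: ler_sum => i _; exact: swap_row.
Qed.

End Lindeberg.

Theorem theorem3p6 (R : realType) :
  exists K : R, 0 < K /\
  forall (c C : R) (n p : nat),
    0 < c -> c <= p%:R / n%:R <= C ->
  forall (d : measure_display) (T : measurableType d) (P : probability T R)
    (X Y : 'I_n -> T -> 'cV[R]_p) (Sigma : 'I_n -> 'M[R]_p)
    (bLX bQX bLY bQY : 'I_n -> nat -> \bar R),
    (forall j, measurable_mx (X j)) ->
    (forall j, measurable_mx (Y j)) ->
    independent_vectors P X ->
    independent_vectors P Y ->
    independent_pair P (sigma_mx (data_mx X)) (sigma_mx (data_mx Y)) ->
    (forall j, mean_zero P (X j)) ->
    (forall j, mean_zero P (Y j)) ->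
    (forall j, has_covariance P (X j) (Sigma j)) ->
    (forall j, has_covariance P (Y j) (Sigma j)) ->
    (forall j, moment_bounds P (X j) (bLX j) (bQX j)) ->
    (forall j, moment_bounds P (Y j) (bLY j) (bQY j)) ->
  forall (r : 'rV[R]_n) (A : 'M[R]_p) (t : R)
    (alpha : 'cV[R]_n) (x : 'cV[R]_p),
    (forall i, 0 < r 0 i) ->
    posdef A ->
    0 < t ->
    loewner_ge A t%:M ->
    enorm alpha = 1 ->
    enorm x = 1 ->
  exists UX UY : 'I_n -> R,
    (`| 'E_P[(fun w => hstat (diag_mx r) A alpha x (data_mx X w)
                       - hstat (diag_mx r) A alpha x (data_mx Y w))%R] |
       <= (K * \sum_(i < n) (UX i + UY i))%:E)%E /\
    forall i : 'I_n,
      UX i <= K * U_bound n t (qform (invmx A) x) (r 0 i) (alpha i 0)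
                    (fine (bLX i 2%N)) (fine (bLX i 4%N)) (fine (bQX i 2%N)) /\
      UY i <= K * U_bound n t (qform (invmx A) x) (r 0 i) (alpha i 0)
                    (fine (bLY i 2%N)) (fine (bLY i 4%N)) (fine (bQY i 2%N)).
Proof.
exists 1; split => // c C n p _ _ d T P X Y Sigma bLX bQX bLY bQY.
move=> mX mY iX iY iXY X0 Y0 XS YS Xb Yb.
move=> r A t alpha x r0 Apd t0 tA a1 x1.
exists (fun i => U_bound n t (qform (invmx A) x) (r 0 i) (alpha i 0)
    (fine (bLX i 2%N)) (fine (bLX i 4%N)) (fine (bQX i 2%N))),
  (fun i => U_bound n t (qform (invmx A) x) (r 0 i) (alpha i 0)
    (fine (bLY i 2%N)) (fine (bLY i 4%N)) (fine (bQY i 2%N))).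
split; last by move=> i; rewrite !mul1r !lexx.
have hI Z : (forall j, measurable_mx (Z j)) -> P.-integrable [set: T]
    (EFin \o (fun w => hstat (diag_mx r) A alpha x (data_mx Z w))).
  move=> mZ.
  apply: (bounded_integrable _ _ (fun w => hstat_le Apd t0 tA _ _ a1 x1)).
  apply: measurable_hstat => // j a.
  by under eq_fun do rewrite mxE; exact: mZ.
have dI := integrableB measurableT (hI X mX) (hI Y mY).
rewrite mul1r unlock -(EFin_normr_Rintegral measurableT dI) lee_fin.
exact: (lindeberg mX mY iX iY iXY X0 Y0 XS YS Xb Yb).
Qed.
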